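(* Let $M$ and $M'$ be modules over $\mathbb{Z}[s^{\pm 1},t^{\pm 1}]$, regarded as Alexander biquandles. Then $M$ and $M'$ are isomorphic as biquandles if and only if there is a map $h$ such that both of the following hold: (i) $h:(1-st)M\to(1-st)M'$ is an isomorphism of $\mathbb{Z}[s^{\pm 1},t^{\pm 1}]$-modules; and (ii) for every set $A\subseteq M$ of coset representatives of $M/(1-st)M$ in which the class $(1-st)M$ is represented by $0\in M$, there is a set $A'\subseteq M'$ of coset representatives of $M'/(1-st)M'$ and a bijection $g:O_s(A)\to O_s(A')$ such that $g(A)=A'$, $$(1-st)g(\alpha)=h((1-st)\alpha)\quad\text{for every } \alpha\in A,$$ and $$g(s\alpha+\omega)=sg(\alpha)+h(\omega)\quad\text{for every } \alpha\in A \text{ and } \omega\in(1-st)M \text{ with } s\alpha+\omega\in O_s(A).$$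
   Context: Here $\mathbb{Z}[s^{\pm 1},t^{\pm 1}]$ is the ring of Laurent polynomials in two commuting variables. Any module $M$ over this ring is a biquandle, called an Alexander biquandle, with the four binary operations $$x^y=tx+(1-st)y,\quad x_y=sx,\quad x^{\overline{y}}=t^{-1}x+(1-s^{-1}t^{-1})y,\quad x_{\overline{y}}=s^{-1}x.$$ A homomorphism of Alexander biquandles is a map of sets $f:M\to M'$ preserving all four operations, i.e. for all $x,y\in M$, $$f(tx+(1-st)y)=tf(x)+(1-st)f(y),\quad f(sx)=sf(x),$$ $$f(t^{-1}x+(1-s^{-1}t^{-1})y)=t^{-1}f(x)+(1-s^{-1}t^{-1})f(y),\quad f(s^{-1}x)=s^{-1}f(x).$$ An isomorphism is a bijective homomorphism; it need not be additive nor send $0$ to $0$. $(1-st)M=\{(1-st)m : m\in M\}$ is a submodule of $M$. A set of coset representatives of $M/(1-st)M$ is a subset of $M$ containing exactly one element of each coset of $(1-st)M$. For a subset $X\subseteq M$, $O_s(X)=\{s^ix : i\in\mathbb{Z},\ x\in X\}$ denotes its orbit under multiplication by powers of $s$ (and similarly for subsets of $M'$). *)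

(* Defs.v *)
From HB Require Import structures.
From mathcomp Require Import all_boot all_order all_algebra.
From mathcomp Require Import boolp classical_sets functions.

Set Implicit Arguments.
Unset Strict Implicit.
Unset Printing Implicit Defensive.

Import GRing.Theory.

Local Open Scope ring_scope.
Local Open Scope classical_set_scope.

Local Notation "x %:F" := (tofrac x).

(** The ring Z[s^+-1, t^+-1] is realised as the subring Z[s, t, 1/(st)] of
    Z(s, t). In {poly {poly int}} the inner variable 'X%:P is s, the outer
    variable 'X is t. *)

Definition is_laurent : {pred {fraction {poly {poly int}}}} := fun x =>
  `[< exists (n : nat) (p : {poly {poly int}}),
        x = p%:F / (('X%:P * 'X)%:F) ^+ n >].

Local Fact st_neq0 : (('X%:P * 'X : {poly {poly int}})%:F) != 0.
Proof. by rewrite tofrac_eq0 mulf_neq0 ?polyC_eq0 ?polyX_eq0. Qed.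

Fact is_laurent_subring : subring_closed is_laurent.
Proof.
split.
- by apply/asboolP; exists 0%N, 1; rewrite expr0 divr1 tofrac1.
- move=> x y /asboolP[m [p ->]] /asboolP[n [q ->]]; apply/asboolP.
  exists (m + n)%N, (p * ('X%:P * 'X) ^+ n - q * ('X%:P * 'X) ^+ m).
  rewrite tofracB !(tofracM _ (_ ^+ _)) !tofracXn exprD mulrBl.
  have dN k : (('X%:P * 'X : {poly {poly int}})%:F) ^+ k != 0.
    by rewrite expf_neq0 ?st_neq0.
  rewrite -[p%:F * _ / _]mulf_div [_ ^+ m * _ ^+ n]mulrC -mulf_div.
  by rewrite !(divff (dN _)) !mulr1.
- move=> x y /asboolP[m [p ->]] /asboolP[n [q ->]]; apply/asboolP.
  by exists (m + n)%N, (p * q); rewrite [(p * q)%:F]tofracM exprD mulf_div.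
Qed.

HB.instance Definition _ := GRing.isSubringClosed.Build
  {fraction {poly {poly int}}} is_laurent is_laurent_subring.

Record laurent := Laurent {
  laurent_val : {fraction {poly {poly int}}};
  laurent_valP : laurent_val \in is_laurent }.

HB.instance Definition _ := [isSub for laurent_val].
HB.instance Definition _ := [Choice of laurent by <:].
HB.instance Definition _ := [SubChoice_isSubComNzRing of laurent by <:].

(** [insubd x y] is [y] when [y] is a Laurent polynomial and [x] otherwise, so
    non-units are their own "inverse", as the library requires. *)
Definition laurent_unit : pred laurent := fun x =>
  (x != 0) && ((val x)^-1 \in is_laurent).
Definition laurent_inv (x : laurent) : laurent := insubd x (val x)^-1.

Local Fact laurent_val_neq0 (x : laurent) : (val x != 0) = (x != 0).
Proof.
have <- : val (0 : laurent) = 0 by exact: raddf0.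
by rewrite (inj_eq val_inj).
Qed.

Local Fact laurent_mulVx : {in laurent_unit, left_inverse 1 laurent_inv *%R}.
Proof.
move=> x /andP[x0 xV]; apply: val_inj.
have -> : val (laurent_inv x * x) = val (laurent_inv x) * val x.
  exact: rmorphM.
have -> : val (1 : laurent) = 1 by exact: rmorph1.
rewrite /laurent_inv val_insubd xV.
by apply: mulVf; rewrite laurent_val_neq0.
Qed.

Local Fact laurent_unitPl (x y : laurent) : y * x = 1 -> laurent_unit x.
Proof.
move=> yx1; have x0 : x != 0.
  by apply: contra_eq_neq yx1 => ->; rewrite mulr0 eq_sym oner_neq0.
apply/andP; split=> //.
suff -> : (val x)^-1 = val y by exact: laurent_valP.
apply: (@mulIf _ (val x)); first by rewrite laurent_val_neq0.
rewrite mulVf ?laurent_val_neq0 //.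
have <- : val (y * x) = val y * val x by exact: rmorphM.
by rewrite yx1; exact: rmorph1.
Qed.

Local Fact laurent_invx_out : {in [predC laurent_unit], laurent_inv =1 id}.
Proof.
move=> x xU; apply: val_inj; rewrite /laurent_inv val_insubd.
case: ifP => // xV; have [->|x0] := eqVneq x 0; first last.
  by move/negP: xU; case; apply/andP.
have -> : val (0 : laurent) = 0 by exact: raddf0.
exact: invr0.
Qed.

HB.instance Definition _ := GRing.ComNzRing_hasMulInverse.Build laurent
  laurent_mulVx laurent_unitPl laurent_invx_out.

Fact is_laurent_polynomial (p : {poly {poly int}}) : p%:F \in is_laurent.
Proof. by apply/asboolP; exists 0%N, p; rewrite expr0 divr1. Qed.

Definition svar : laurent := Laurent (is_laurent_polynomial 'X%:P).
Definition tvar : laurent := Laurent (is_laurent_polynomial 'X).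

Fact svar_unit : svar \is a GRing.unit.
Proof.
apply/andP; split.
  by rewrite -laurent_val_neq0 tofrac_eq0 polyC_eq0 polyX_eq0.
apply/asboolP; exists 1%N, 'X.
rewrite expr1 tofracM invfM [_ / 'X%:F]mulrC mulrA mulfV ?mul1r //.
by rewrite tofrac_eq0 polyX_eq0.
Qed.

Fact tvar_unit : tvar \is a GRing.unit.
Proof.
apply/andP; split.
  by rewrite -laurent_val_neq0 tofrac_eq0 polyX_eq0.
apply/asboolP; exists 1%N, 'X%:P.
rewrite expr1 tofracM invfM mulrA mulfV ?mul1r //.
by rewrite tofrac_eq0 polyC_eq0 polyX_eq0.
Qed.

Section AlexanderBiquandle.
Variable M : lmodType laurent.
Implicit Types x y : M.

(** The operations x^y, x_y, x^{\bar y}, x_{\bar y}, in this order. *)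
Definition bq_up x y : M := tvar *: x + (1 - svar * tvar) *: y.
Definition bq_down x y : M := svar *: x.
Definition bq_upbar x y : M := tvar^-1 *: x + (1 - svar^-1 * tvar^-1) *: y.
Definition bq_downbar x y : M := svar^-1 *: x.

End AlexanderBiquandle.

Definition biquandle_hom (M M' : lmodType laurent) (f : M -> M') : Prop :=
  forall x y : M,
    [/\ f (bq_up x y) = bq_up (f x) (f y),
        f (bq_down x y) = bq_down (f x) (f y),
        f (bq_upbar x y) = bq_upbar (f x) (f y)
      & f (bq_downbar x y) = bq_downbar (f x) (f y)].

Definition biquandle_isomorphic (M M' : lmodType laurent) : Prop :=
  exists2 f : M -> M', biquandle_hom f & bijective f.

Section OneMinusST.
Variable M : lmodType laurent.

Definition in_onest : {pred M} := fun x =>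
  `[< exists m : M, x = (1 - svar * tvar) *: m >].

Fact in_onest_submod : submod_closed in_onest.
Proof.
split; first by apply/asboolP; exists 0; rewrite scaler0.
move=> a x y /asboolP[m ->] /asboolP[n ->]; apply/asboolP.
by exists (a *: m + n); rewrite scalerDr !scalerA mulrC.
Qed.

HB.instance Definition _ := GRing.isSubmodClosed.Build
  laurent M in_onest in_onest_submod.

(** [onest M] is the submodule (1 - st)M of M. *)
Record onest := Onest { onest_val : M; onest_valP : onest_val \in in_onest }.

HB.instance Definition _ := [isSub for onest_val].
HB.instance Definition _ := [Choice of onest by <:].
HB.instance Definition _ := [SubChoice_isSubLmodule of onest by <:].

Fact in_onest_scale (m : M) : (1 - svar * tvar) *: m \in in_onest.
Proof. by apply/asboolP; exists m. Qed.

Definition onest_scale (m : M) : onest := Onest (in_onest_scale m).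

Definition coset_representatives (A : set M) : Prop :=
  forall x : M, exists! a : M, A a /\ exists w : onest, a = x + val w.

Definition s_orbit (X : set M) : set M :=
  [set y | exists (i : int) (x : M), X x /\ y = svar ^ i *: x].

End OneMinusST.

(* Main.v *)
Require Import Defs.
From HB Require Import structures.
From mathcomp Require Import all_boot all_order all_algebra.
From mathcomp Require Import boolp classical_sets functions.

Local Open Scope ring_scope.
Local Open Scope classical_set_scope.

(* Put [u = 1 - st]. An isomorphism [f], translated so that [f 0 = 0], commutes
    with [s] and [t] and satisfies [f (x + u y) = f x + u f(y)]; so it restricts
    to a linear map [h : uM -> uM'], and [g = f], [A' = f(A)] fit every [A].
    Conversely, given [h] and [g] for one [A], put
    [f (a + w) = g a + h w] for [a] in [A] and [w] in [uM]. Compatibility with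
    [s] is the last condition on [g]. Compatibility with [t] also reduces to it:
    if [t a = c + r] with [c] in [A] and [r] in [uM], then
    [a = s c + (u a + s r)], whence [g a = s g(c) + u g(a) + s h(r)], that is
    [t g(a) = g c + h r]. *)

Set Implicit Arguments.
Unset Strict Implicit.
Unset Printing Implicit Defensive.

Import GRing.Theory.

Local Notation onemst := (1 - svar * tvar).

Lemma onemst_scale (V : lmodType laurent) (x : V) :
  onemst *: x = x - svar *: (tvar *: x).
Proof. by rewrite scalerBl scale1r scalerA. Qed.

(** * Multiplication by a unit scalar is invertible *)

Section UnitScaling.
Variables (R : unitRingType) (V : lmodType R) (a : R).
Hypothesis ua : a \is a GRing.unit.

Lemma unit_scalerK : cancel ( *:%R a : V -> V) ( *:%R a^-1).
Proof. by move=> x; rewrite scalerA mulVr // scale1r. Qed.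

Lemma unit_scalerKV : cancel ( *:%R a^-1 : V -> V) ( *:%R a).
Proof. by move=> x; rewrite scalerA mulrV // scale1r. Qed.

Lemma unit_scalerI : injective ( *:%R a : V -> V).
Proof. exact: (can_inj unit_scalerK). Qed.

End UnitScaling.

(** * From commutation with s and t to linearity over Laurent polynomials *)

Section ScalableLaurent.
Variables (V W : lmodType laurent) (f : {additive V -> W}).

Let commutes (a : laurent) := forall x, f (a *: x) = a *: f x.

Let commutesM a b : commutes a -> commutes b -> commutes (a * b).
Proof. by move=> fa fb x; rewrite -!scalerA fa fb. Qed.

Let commutesD a b : commutes a -> commutes b -> commutes (a + b).
Proof. by move=> fa fb x; rewrite !scalerDl raddfD fa fb. Qed.

Let commutes_int (n : int) : commutes n%:~R.
Proof. by move=> x; rewrite !scaler_int raddfMz. Qed.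

Let commutesV a : a \is a GRing.unit -> commutes a -> commutes a^-1.
Proof.
by move=> ua fa x; apply: (unit_scalerI ua); rewrite -fa !unit_scalerKV.
Qed.

Definition laurent_of_poly (p : {poly {poly int}}) : laurent :=
  Laurent (is_laurent_polynomial p).

Let lpD p q : laurent_of_poly (p + q) = laurent_of_poly p + laurent_of_poly q.
Proof. by apply: val_inj; rewrite [RHS]raddfD /= tofracD. Qed.

Let lpM p q : laurent_of_poly (p * q) = laurent_of_poly p * laurent_of_poly q.
Proof. by apply: val_inj; rewrite [RHS]rmorphM /= tofracM. Qed.

Let lp_int (n : int) : laurent_of_poly n%:P%:P = n%:~R.
Proof.
apply: val_inj; rewrite [RHS]rmorph_int /=.
by rewrite -[n in LHS]intz !rmorph_int.
Qed.

(** The scalars that commute with an additive [f] contain the integers and are closed under sums,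
    products and inverses of units. Hence s and t generate all the rest. *)
Lemma laurent_scalable :
  (forall x, f (svar *: x) = svar *: f x) ->
  (forall x, f (tvar *: x) = tvar *: f x) ->
  forall a x, f (a *: x) = a *: f x.
Proof.
move=> fs ft.
(* The outer induction is on polynomials in t, the inner one on their coefficients, which are
   polynomials in s. *)
have f_poly p : commutes (laurent_of_poly p).
  elim/poly_ind: p => [|p c IHp]; first by rewrite -!polyC0 lp_int.
  rewrite lpD lpM; apply: commutesD; first exact: commutesM.
  elim/poly_ind: c => [|c n IHc]; first by rewrite lp_int.
  rewrite polyCD polyCM lpD lpM; apply: commutesD; last by rewrite lp_int.
  exact: commutesM.
move=> a; rewrite -/(commutes a).
have ust : svar * tvar \is a GRing.unit by rewrite unitrM svar_unit tvar_unit.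
have /asboolP[n [p ap]] := laurent_valP a.
have -> : a = laurent_of_poly p * (svar * tvar)^-1 ^+ n.
  apply: (mulIr (unitrX n ust)); rewrite -mulrA exprVn mulVr ?unitrX // mulr1.
  apply: val_inj; rewrite rmorphM rmorphXn rmorphM /= ap -tofracM mulfVK //.
  by rewrite expf_neq0 // tofrac_eq0 mulf_neq0 ?polyC_eq0 ?polyX_eq0.
apply: commutesM => //; elim: n {ap} => [|n IHn]; first exact: (commutes_int 1).
by rewrite exprS; apply: commutesM => //; apply/commutesV/commutesM.
Qed.

End ScalableLaurent.

(** * Biquandle homomorphisms and normalisation at 0 *)

Section Homomorphisms.
Variables M M' : lmodType laurent.
Implicit Type f : M -> M'.

(** The barred operations are recovered by inverting the unbarred ones: applying [bq_up] with second
    argument [svar^-1 *: y] to [bq_upbar x y] gives back [x]. *)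
Lemma biquandle_homP f : biquandle_hom f <->
  (forall x, f (svar *: x) = svar *: f x) /\
  (forall x y, f (tvar *: x + onemst *: y) = tvar *: f x + onemst *: f y).
Proof.
split=> [fh|[fs fu] x y].
  by split=> [x|x y]; [case: (fh x 0) | case: (fh x y)].
have fsV z : f (svar^-1 *: z) = svar^-1 *: f z.
  by apply: (unit_scalerI svar_unit); rewrite -fs !unit_scalerKV ?svar_unit.
have coefE : 1 - svar^-1 * tvar^-1 = - (tvar^-1 * (onemst * svar^-1)).
  rewrite mulrBl mul1r mulrBr mulrAC mulrV ?svar_unit // mul1r.
  by rewrite mulVr ?tvar_unit // opprB mulrC.
split; [exact: fu | exact: fs | rewrite /bq_upbar | exact: fsV].
apply: (unit_scalerI tvar_unit).
apply: (addIr (onemst *: (svar^-1 *: f y))); rewrite -fsV -fu fsV.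
have bar (V : lmodType laurent) (a b : V) :
    tvar *: (tvar^-1 *: a + (1 - svar^-1 * tvar^-1) *: b) +
      onemst *: (svar^-1 *: b) = a.
  rewrite scalerDr unit_scalerKV ?tvar_unit // coefE scaleNr scalerN -!scalerA.
  by rewrite unit_scalerKV ?tvar_unit // addrNK.
by rewrite !bar.
Qed.

(** The element [f 0] is fixed by s and by t + (1 - st), so translating by it preserves both
    identities of [biquandle_homP]. *)
Lemma biquandle_isomorphic_pointed : biquandle_isomorphic M M' ->
  exists f : M -> M', [/\ bijective f, f 0 = 0 & biquandle_hom f].
Proof.
case=> f /biquandle_homP[fs fu] [f' fK f'K].
have s0 : svar *: f 0 = f 0 by rewrite -fs scaler0.
exists (fun x => f x - f 0); split; last 1 first.
- apply/biquandle_homP; split=> [x|x y]; first by rewrite fs scalerBr s0.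
  rewrite fu !scalerBr addrACA -opprD; congr (_ - _).
  by have := fu 0 0; rewrite !scaler0 addr0.
- exists (fun y => f' (y + f 0)) => z; first by rewrite subrK fK.
  by rewrite f'K addrK.
- exact: subrr.
Qed.

End Homomorphisms.

(** * Representatives of the cosets of (1 - st)M *)

Section Cosets.
Variable M : lmodType laurent.
Implicit Types (x y : M) (w : onest M) (A : set M).

Lemma val_onestD w v : val (w + v) = val w + val v.
Proof. exact: raddfD. Qed.

Lemma val_onestN w : val (- w) = - val w.
Proof. exact: raddfN. Qed.

Lemma val_onestB w v : val (w - v) = val w - val v.
Proof. exact: raddfB. Qed.

Lemma val_onestZ a w : val (a *: w) = a *: val w.
Proof. exact: linearZ. Qed.

Lemma onestP w : exists y, w = onest_scale y.
Proof.
by have /asboolP[y wE] := onest_valP w; exists y; apply: val_inj.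
Qed.

Lemma coset_representatives_decomp A : coset_representatives A ->
  exists p : M -> M * onest M, forall x, A (p x).1 /\ x = (p x).1 + val (p x).2.
Proof.
move=> cA.
suff /choice[p pP] x : exists p : M * onest M, A p.1 /\ x = p.1 + val p.2.
  by exists p.
have [a [[Aa [w aE]] _]] := cA x.
have xE : x = a + val (- w) by rewrite val_onestN aE addrK.
by exists (a, - w).
Qed.

Lemma coset_representatives_inj A a b w : coset_representatives A ->
  A a -> A b -> a = b + val w -> a = b.
Proof.
move=> cA Aa Ab abw; have [c [_ cu]] := cA b.
rewrite -(cu a); last by split=> //; exists w.
by apply: cu; split=> //; exists 0; rewrite raddf0 addr0.
Qed.

Lemma exists_coset_representatives :
  exists2 A : set M, coset_representatives A & A 0.
Proof.
(* The case split forces 0 to represent the submodule itself; on other cosets [choose] gives a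
   canonical element. *)
pose r x := if x \in @in_onest M then 0
            else choose (fun y => y - x \in @in_onest M) x.
have rP x : r x - x \in @in_onest M.
  rewrite /r; case: ifP => xN; first by rewrite sub0r rpredN.
  by apply: (@chooseP _ (fun y => y - x \in @in_onest M)); rewrite subrr rpred0.
have rE x w : r (x + val w) = r x.
  have wN : val w \in @in_onest M by exact: valP.
  rewrite /r rpredDr //; case: ifP => // xN.
  (* Both points define the same coset, and the default passed to [choose] does not affect its
     result once both defaults lie in that coset. *)
  have PE : (fun y => y - (x + val w) \in @in_onest M) =1
      (fun y => y - x \in @in_onest M).
    by move=> y; rewrite opprD addrA rpredBr.
  rewrite (eq_choose PE); apply: choose_id; last by rewrite subrr rpred0.
  by rewrite addrAC subrr add0r.
exists (range r); last by exists 0; rewrite // /r rpred0.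
move=> x; exists (r x); split=> [|_ [[y _ <-] [w ryw]]].
  by split; [exists x | exists (Onest (rP x)); rewrite /= addrC subrK].
have -> : x = y + val (Onest (rP y) - w).
  by rewrite val_onestB addrA [y + _]addrC subrK ryw addrK.
exact: rE.
Qed.

End Cosets.

(** * The two directions of the equivalence *)

Section Theorem4.
Variables M M' : lmodType laurent.

Lemma isomorphic_linear_representatives :
  biquandle_isomorphic M M' ->
  exists h : {linear onest M -> onest M'},
    bijective h /\
    forall A : set M, coset_representatives A -> A 0 ->
      exists (A' : set M') (g : M -> M'),
        [/\ coset_representatives A',
            set_bij (s_orbit A) (s_orbit A') g,
            g @` A = A',
            forall a : M, A a ->
              (1 - svar * tvar) *: g a = val (h (onest_scale a))
          & forall (a : M) (w : onest M), A a ->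
              s_orbit A (svar *: a + val w) ->
              g (svar *: a + val w) = svar *: g a + val (h w)].
Proof.
move=> /biquandle_isomorphic_pointed[f [[f' fK f'K] f0 /biquandle_homP[fs fut]]].
have ft x : f (tvar *: x) = tvar *: f x.
  by have := fut x 0; rewrite f0 !scaler0 !addr0.
have fu x : f (onemst *: x) = onemst *: f x.
  by have := fut 0 x; rewrite f0 !scaler0 !add0r.
(* Writing x = t (t^-1 x) turns x + (1 - st)y into [bq_up (tvar^-1 *: x) y]. *)
have fD x (w : onest M) : f (x + val w) = f x + f (val w).
  have [y ->] := onestP w.
  by rewrite /= -[x in LHS](unit_scalerKV tvar_unit) fut -ft unit_scalerKV ?tvar_unit // fu.
have fN (w : onest M) : f (val w) \in @in_onest M'.
  by have [y ->] := onestP w; rewrite /= fu in_onest_scale.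
pose h0 w : onest M' := Onest (fN w).
have h0B : zmod_morphism h0.
  move=> w v; apply: val_inj; rewrite val_onestB.
  apply: (addIr (f (val v))); rewrite -[val (h0 _)]/(f (val (w - v))) -fD.
  by rewrite val_onestB !subrK.
(* Only additivity is packed here, so that [laurent_scalable] can supply the scalability needed to
   pack [h]. *)
pose hA : {additive onest M -> onest M'} :=
  HB.pack h0 (GRing.isZmodMorphism.Build _ _ h0 h0B).
have h0Z : scalable h0.
  apply: (@laurent_scalable _ _ hA) => w; apply: val_inj; rewrite val_onestZ.
    by rewrite -[LHS]/(f (val (svar *: w))) val_onestZ fs.
  by rewrite -[LHS]/(f (val (tvar *: w))) val_onestZ ft.
pose h : {linear onest M -> onest M'} :=
  HB.pack h0 (GRing.isZmodMorphism.Build _ _ h0 h0B)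
    (GRing.isScalable.Build _ _ _ _ h0 h0Z).
have hE w : val (h w) = f (val w) by [].
have h_onto (w' : onest M') : exists w, w' = h w.
  have [y ->] := onestP w'; exists (onest_scale (f' y)).
  by apply: val_inj; rewrite hE /= fu f'K.
exists h; split.
  have [h' h'E] := choice h_onto.
  exists h' => w; last by rewrite -h'E.
  by apply/val_inj/(can_inj fK); rewrite -!hE -h'E.
have fsV x : f (svar^-1 *: x) = svar^-1 *: f x.
  by apply: (unit_scalerI svar_unit); rewrite -fs !unit_scalerKV ?svar_unit.
have fsX n x : f (svar ^+ n *: x) = svar ^+ n *: f x.
  by elim: n x => [|n IHn] x; rewrite ?scale1r // exprSr -!scalerA IHn fs.
have fsVX n x : f (svar ^- n *: x) = svar ^- n *: f x.
  rewrite -exprVn.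
  by elim: n x => [|n IHn] x; rewrite ?scale1r // exprSr -!scalerA IHn fsV.
have fsXz (i : int) x : f (svar ^ i *: x) = svar ^ i *: f x.
  by case: i => n; [exact: fsX | exact: fsVX].
move=> A cA A0; exists (f @` A), f; split=> //.
(* The coset of x' is represented by the image of the representative of f' x'. Uniqueness pulls back
   along [f] because [h] is onto. *)
- move=> x'; have [a [[Aa [w aE]] au]] := cA (f' x').
  exists (f a); split=> [|_ [[b Ab <-] [w' bE]]].
    by split; [exists a | exists (h w); rewrite aE fD f'K].
  congr f; apply: au; split=> //; have [v w'E] := h_onto w'.
  by exists v; apply: (can_inj fK); rewrite fD f'K bE w'E.
- split.
  + by move=> _ [i [a [Aa ->]]]; exists i, (f a); split; [exists a | ].
  + by move=> x y _ _; exact: (can_inj fK).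
  + move=> _ [i [_ [[a Aa <-] ->]]]; exists (svar ^ i *: a) => //.
    by exists i, a.
- by move=> a _; rewrite hE /= fu.
- by move=> a w _ _; rewrite fD fs.
Qed.

Lemma linear_representatives_isomorphic (h : {linear onest M -> onest M'})
    (A : set M) (A' : set M') (g : M -> M') :
  bijective h -> coset_representatives A -> coset_representatives A' ->
  set_bij (s_orbit A) (s_orbit A') g -> g @` A = A' ->
  (forall a, A a -> onemst *: g a = val (h (onest_scale a))) ->
  (forall a w, A a -> s_orbit A (svar *: a + val w) ->
    g (svar *: a + val w) = svar *: g a + val (h w)) ->
  biquandle_isomorphic M M'.
Proof.
move=> [h' hK h'K] cA cA' [_ ginj _] gA gu gs.
have orbA a : A a -> s_orbit A a.
  by move=> Aa; exists 0, a; rewrite expr0z scale1r.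
have {}ginj a b : A a -> A b -> g a = g b -> a = b.
  by move=> Aa Ab; apply: ginj; rewrite inE; exact: orbA.
have A'g a : A a -> A' (g a) by move=> Aa; rewrite -gA; exists a.
have {}gs a b (w : onest M) : A a -> A b -> b = svar *: a + val w ->
    g b = svar *: g a + val (h w).
  by move=> Aa Ab bE; rewrite bE gs // -bE; exact: orbA.
have [p pP] := coset_representatives_decomp cA.
pose f x := g (p x).1 + val (h (p x).2).
(* Decompositions along [A] are unique, so [f] may be computed from any of them, not just the one
   chosen by [p]. *)
have fE a w : A a -> f (a + val w) = g a + val (h w).
  move=> Aa; have [Ap pE] := pP (a + val w).
  have ap : a = (p (a + val w)).1.
    apply: (coset_representatives_inj (w := (p (a + val w)).2 - w) cA) => //.
    by rewrite val_onestB addrA -pE addrK.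
  rewrite /f -ap; congr (_ + val (h _)); apply: val_inj.
  by apply: (addrI a); rewrite [X in X + _ = _]ap -pE.
have hV a w : onemst *: (g a + val (h w)) = onemst *: g a + val (h (onemst *: w)).
  by rewrite scalerDr linearZ val_onestZ.
have hD w v : h (w + v) = h w + h v by exact: linearD.
have hN w : h (- w) = - h w by exact: linearN.
have hZ c w : h (c *: w) = c *: h w by exact: linearZ.
exists f.
  apply/biquandle_homP; split=> [x|x y].
    have [Aa xE] := pP x; set a := (p x).1 in Aa xE; set w := (p x).2 in xE.
    have [Ab bE] := pP (svar *: a).
    set b := (p _).1 in Ab bE; set v := (p _).2 in bE.
    (* Since s a = b + v, the representative b has the form s a + (-v) required by the condition on
       [g]. *)
    have gb : g b = svar *: g a + val (h (- v)).
      by apply: gs => //; rewrite val_onestN bE addrK.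
    rewrite xE fE // scalerDr bE -addrA -val_onestZ -val_onestD fE // gb.
    rewrite hD hN hZ val_onestD val_onestN val_onestZ scalerDr.
    by rewrite -addrA addKr.
  have [Aa xE] := pP x; set a := (p x).1 in Aa xE; set w := (p x).2 in xE.
  have [Ac cE] := pP (tvar *: a).
  set c := (p _).1 in Ac cE; set r := (p _).2 in cE.
  have ga : g a = svar *: g c + val (h (onest_scale a + svar *: r)).
    apply: gs => //; rewrite val_onestD val_onestZ addrCA -scalerDr -cE.
    by rewrite /= onemst_scale subrK.
  (* Expanding (1 - st) g(a) as g(a) - st g(a) cancels g(a) in [ga]; the remaining factor s is a
     unit. *)
  have gc : tvar *: g a = g c + val (h r).
    apply: (unit_scalerI svar_unit).
    move: ga; rewrite hD val_onestD -gu // hZ val_onestZ onemst_scale.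
    rewrite scalerDr addrCA => /(canLR (addKr _)).
    by rewrite opprB addrNK => ->.
  (* The condition on [g] at the representative of y extends to y itself by linearity of [h]. *)
  have hu : val (h (onest_scale y)) = onemst *: f y.
    have [Ab yE] := pP y.
    rewrite /f hV gu // -val_onestD -hD; congr (val (h _)).
    by apply: val_inj; rewrite val_onestD val_onestZ -scalerDr -yE.
  rewrite -hu {1}xE scalerDr cE -!addrA -val_onestZ.
  rewrite -[onemst *: y]/(val (onest_scale y)).
  rewrite -!val_onestD fE // xE fE // scalerDr gc !hD hZ !val_onestD val_onestZ.
  by rewrite !addrA.
have finj : injective f.
  move=> x y; have [Aa xE] := pP x; have [Ab yE] := pP y.
  rewrite /f; set a := (p x).1 in Aa xE *; set w := (p x).2 in xE *.
  set b := (p y).1 in Ab yE *; set v := (p y).2 in yE *.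
  (* Equal values put g(a) and g(b) in one coset, where [A'] has a single element; injectivity of
     [g] then gives a = b, and that of [h] gives w = v. *)
  move=> fxy; have ab : a = b.
    apply: ginj => //.
    apply: (coset_representatives_inj (w := h v - h w) cA'); try exact: A'g.
    by rewrite val_onestB addrA -fxy addrK.
  by move: fxy; rewrite xE yE -ab => /addrI/val_inj/(can_inj hK) ->.
have [p' p'P] := coset_representatives_decomp cA'.
have fsurj y : exists x, y = f x.
  have [A'a yE] := p'P y; move: A'a; rewrite -{1}gA => -[a Aa aE].
  by exists (a + val (h' (p' y).2)); rewrite fE // h'K aE.
have [f' f'E] := choice fsurj.
by exists f' => x; [apply: finj; rewrite -f'E | rewrite -f'E].
Qed.

End Theorem4.

Theorem theorem4 (M M' : lmodType laurent) :
  biquandle_isomorphic M M' <->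
  exists h : {linear onest M -> onest M'},
    bijective h /\
    forall A : set M, coset_representatives A -> A 0 ->
      exists (A' : set M') (g : M -> M'),
        [/\ coset_representatives A',
            set_bij (s_orbit A) (s_orbit A') g,
            g @` A = A',
            forall a : M, A a ->
              (1 - svar * tvar) *: g a = val (h (onest_scale a))
          & forall (a : M) (w : onest M), A a ->
              s_orbit A (svar *: a + val w) ->
              g (svar *: a + val w) = svar *: g a + val (h w)].
Proof.
split; first exact: isomorphic_linear_representatives.
case=> h [hbij hP]; have [A cA A0] := exists_coset_representatives M.
have [A' [g [cA' gbij gA gu gs]]] := hP A cA A0.
exact: linear_representatives_isomorphic hbij cA cA' gbij gA gu gs.
Qed.
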